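(* For every integer $k\ge 2$ and every $\ell\in\{1,2\}$, there exists a cop-winning (undirected) edge periodic cycle $\mathcal{G}=(V,E,\tau)$ with $\max(L_{\mathcal{G}})=k$ and $|V| = 2\cdot \ell\cdot \mathrm{LCM}(L_{\mathcal{G}})-1$.
   Context: An edge periodic graph $\mathcal{G}=(V,E,\tau)$ consists of a finite undirected graph $G=(V,E)$ and a function $\tau: E\to\{0,1\}^*$ such that edge $e$ exists in time step $t\ge 0$ if and only if $\tau(e)[t \bmod |\tau(e)|]=1$; every edge exists in at least one time step. An edge periodic cycle is one whose underlying graph $G$ is a single cycle. $L_{\mathcal{G}}=\{|\tau(e)| : e\in E\}$ is the set of edge periods, $\max(L_{\mathcal{G}})$ its maximum and $\mathrm{LCM}(L_{\mathcal{G}})$ its least common multiple. The one-cop game: first the cop chooses a start vertex, then the robber; then in each time step $t=0,1,2,\dots$, first the cop and then the robber either stays or moves to an adjacent vertex along an edge present at time $t$. The cop catches the robber if after the cop's move in some time step both are on the same vertex. $\mathcal{G}$ is cop-winning if the cop has a strategy (including start vertex) catching the robber regardless of the robber's start vertex and moves. *)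

(* Defs.v *)
From mathcomp Require Import all_boot.
Set Implicit Arguments.
Unset Strict Implicit.
Unset Printing Implicit Defensive.

(* Whether an edge labelled by the word w exists at time t; an empty word
   yields an edge that never exists. *)
Definition exists_at (w : seq bool) (t : nat) : bool :=
  nth false w (t %% size w).

(* Edges are unordered pairs of distinct vertices. The labelling tau is total
   on {set V}, but only its values on ep_edges are ever used. *)
Record ep_graph (V : finType) := EPGraph {
  ep_edges : {set {set V}};
  ep_tau : {set V} -> seq bool;
  ep_edges_card2 : forall e, e \in ep_edges -> #|e| = 2;
  ep_edges_exist : forall e, e \in ep_edges -> exists t, exists_at (ep_tau e) t
}.

Section EdgePeriodicGraph.
Variables (V : finType) (G : ep_graph V).

Definition ep_periods : seq nat :=
  undup [seq size (ep_tau G e) | e in ep_edges G].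

Definition ep_max : nat := \max_(p <- ep_periods) p.

Definition ep_lcm : nat := \big[lcmn/1]_(p <- ep_periods) p.

(* next c v is the cyclic successor of v in c. *)
Definition is_ep_cycle : Prop :=
  exists c : seq V,
    [/\ uniq c, 3 <= size c, forall v, v \in c &
        ep_edges G = [set [set v; next c v] | v : V]].

Definition legal_move (t : nat) (u v : V) : Prop :=
  u = v \/ ([set u; v] \in ep_edges G /\ exists_at (ep_tau G [set u; v]) t).

(* r 0 is the robber's start vertex and r t.+1 its position after time step
   t. *)
Definition robber_run (r : nat -> V) : Prop :=
  forall t, legal_move t (r t) (r t.+1).

(* A cop strategy is a start vertex c0, chosen before the robber's, and a map
   sigma from the robber's positions so far to the cop's next vertex; the
   cop's own past positions are determined by these. cop_run r t.+1 is the
   cop's position after its move in time step t, made knowing only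
   r 0, ..., r t. *)
Definition cop_run (c0 : V) (sigma : seq V -> V) (r : nat -> V) (t : nat) : V :=
  if t is s.+1 then sigma (mkseq r s.+1) else c0.

(* The robber still occupies r t just after the cop's move in time step t. *)
Definition cop_winning : Prop :=
  exists (c0 : V) (sigma : seq V -> V), forall r : nat -> V, robber_run r ->
    (forall t, legal_move t (cop_run c0 sigma r t) (cop_run c0 sigma r t.+1)) /\
    (exists t, cop_run c0 sigma r t.+1 = r t).

End EdgePeriodicGraph.

(* Main.v *)
Require Import Defs.
From mathcomp Require Import all_boot.
From mathcomp Require Import zify.
Set Implicit Arguments.
Unset Strict Implicit.
Unset Printing Implicit Defensive.


(** All edges get period [k], so the least common multiple of the periods is [k].
The cycle is symmetric about the cop's start vertex [0], so we may assume that
the robber starts on the positive side, and the cop just walks in the positive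
direction, stopping only if the robber steps onto it.

For [l = 1] the only restricted edge is the one opposite to [0]; it opens first
at time [k - 1], when the cop has already swept the half containing the robber.

For [l = 2] the two edges at [0] open at times [0] mod [k] and the opposite edge
at times [k - 1] mod [k]. The robber has to use the opposite edge at time
[k - 1], the cop follows through it at time [2k - 1], and the robber cannot pass
the two edges at [0], which takes an extra period, before the cop arrives. *)

Lemma exists_at_mkseq (P : nat -> bool) (k t : nat) :
  0 < k -> exists_at (mkseq P k) t = P (t %% k).
Proof. by move=> k0; rewrite /exists_at size_mkseq nth_mkseq // ltn_mod. Qed.

(** * Cop strategies that follow a walk fixed by the robber's start *)

Section Patrol.
Variables (V : finType) (G : ep_graph V).

(** [q x] is the walk planned against a robber starting at [x]. [find] gives the first time at which
    the robber stood on the planned vertex, and [size s] if there is none, so that the walk goes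
    on. *)
Definition patrol_strategy (q : V -> nat -> V) (c0 : V) (s : seq V) : V :=
  q (head c0 s)
    (find (fun i => nth c0 s i == q (head c0 s) i) (iota 0 (size s))).

Lemma cop_run_patrol (q : V -> nat -> V) (c0 : V) (r : nat -> V) (t : nat) :
  q (r 0) 0 = c0 ->
  cop_run c0 (patrol_strategy q c0) r t =
  q (r 0) (find (fun i => r i == q (r 0) i) (iota 0 t)).
Proof.
case: t => [|t] q0 //; rewrite /cop_run /patrol_strategy size_mkseq.
have -> : head c0 (mkseq r t.+1) = r 0 by [].
congr (q _ _); apply: eq_in_find => i; rewrite mem_iota => /andP[_ it].
by rewrite nth_mkseq.
Qed.

(* The robber may step onto the cop's vertex, which is a capture only after the
   cop's next move; hence the cop stops as soon as this happens. *)
Lemma cop_winning_patrol (c0 : V) (q : V -> nat -> V) :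
  (forall x, q x 0 = c0) ->
  (forall x t, legal_move G t (q x t) (q x t.+1)) ->
  (forall r, robber_run G r ->
     exists t, r t = q (r 0) t \/ r t = q (r 0) t.+1) ->
  cop_winning G.
Proof.
move=> q0 q_legal q_meets; exists c0, (patrol_strategy q c0) => r r_run.
pose a i := r i == q (r 0) i.
have runE t : cop_run c0 (patrol_strategy q c0) r t = q (r 0) (find a (iota 0 t)).
  exact: cop_run_patrol.
have iotaS t : iota 0 t.+1 = iota 0 t ++ [:: t] by rewrite -addn1 iotaD.
have find_none t : ~~ has a (iota 0 t) -> find a (iota 0 t) = t.
  by move/hasNfind ->; rewrite size_iota.
split=> [t|].
  rewrite !runE iotaS find_cat; case: ifP => [_|/negbT an]; first by left.
  rewrite size_iota find_none //=; case: (a t); last by rewrite addn1.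
  by rewrite addn0; left.
have [t meet] := q_meets r r_run.
(* If the robber has already stood on the planned vertex, the first such time is a capture;
   otherwise the cop is still on schedule and moves onto the robber. *)
case: (boolP (has a (iota 0 t.+1))) => [ha|hn].
  have lt : find a (iota 0 t.+1) < t.+1 by rewrite -{2}(size_iota 0 t.+1) -has_find.
  exists (find a (iota 0 t.+1)).
  set j := find a _ in lt *.
  have aj : a j by have := nth_find 0 ha; rewrite nth_iota // add0n.
  have jn : ~~ has a (iota 0 j).
    apply/hasPn => i; rewrite mem_iota => /andP[_ ij].
    have := before_find 0 ij; rewrite nth_iota ?add0n; last by lia.
    by move->.
  by rewrite runE iotaS find_cat (negbTE jn) size_iota /= aj addn0 (eqP aj).
exists t; rewrite runE find_none //.
case: meet => // rt; case/negP: hn; apply/hasP; exists t; last exact/eqP.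
by rewrite mem_iota /= add0n.
Qed.

(* The cop plays [p] or its mirror image, according to the side of the
   reflection [f] on which the robber starts. *)
Lemma cop_winning_reflection (f : V -> V) (D : pred V) (p : nat -> V) :
  involutive f -> f (p 0) = p 0 ->
  (forall t u v, legal_move G t u v -> legal_move G t (f u) (f v)) ->
  (forall x, D x || D (f x)) ->
  (forall t, legal_move G t (p t) (p t.+1)) ->
  (forall r, robber_run G r -> D (r 0) ->
     exists t, r t = p t \/ r t = p t.+1) ->
  cop_winning G.
Proof.
move=> fK f0 f_legal fD p_legal p_meets.
apply: (@cop_winning_patrol (p 0) (fun x t => if D x then p t else f (p t))).
- by move=> x; case: ifP.
- by move=> x t; case: ifP => _ //; apply: f_legal.
move=> r r_run; case: (boolP (D (r 0))) => [|nD]; first exact: p_meets.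
have Df : D (f (r 0)) by have := fD (r 0); rewrite (negbTE nD).
have [t meet] := p_meets (fun t => f (r t)) (fun t => f_legal _ _ _ (r_run t)) Df.
by exists t; case: meet => [<-|<-]; [left|right]; rewrite fK.
Qed.

End Patrol.

(** * Cycles whose edges all have period [k] *)

Section PeriodicCycle.
(* [S i t] tells whether the edge from [i] to its cyclic successor is present
   at the times congruent to [t] modulo [k]. *)
Variables (n k : nat) (S : nat -> nat -> bool).
Hypotheses (n_ge3 : 3 <= n) (k_gt0 : 0 < k).
Hypothesis S_some : forall i, i < n -> exists2 t, t < k & S i t.

Definition cycle_edge (i : 'I_n) : {set 'I_n} := [set i; ordS i].

Lemma val_ordS (i : 'I_n) : ordS i = (if i.+1 == n then 0 else i.+1) :> nat.
Proof.
rewrite /=; case: eqP => [->|ne]; first by rewrite modnn.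
by rewrite modn_small //; have := ltn_ord i; lia.
Qed.

Lemma ord_eqE (i j : 'I_n) : (i == j) = (i == j :> nat).
Proof. by []. Qed.

Lemma ordS_neq (i : 'I_n) : i != ordS i.
Proof.
by rewrite ord_eqE val_ordS; have := ltn_ord i; case: (i.+1 =P n); lia.
Qed.

(** This needs [3 <= n]: for [n = 2] both edges would be the same pair. It makes the index picked in
    [cycle_tau] unique. *)
Lemma cycle_edge_inj : injective cycle_edge.
Proof.
move=> i j /setP e; apply: ord_inj => /=.
have := e i; have := e (ordS i); have := e j; have := e (ordS j).
rewrite /cycle_edge !inE !eqxx ?orbT !ord_eqE !val_ordS.
have := ltn_ord i; have := ltn_ord j.
by case: (i.+1 =P n); case: (j.+1 =P n); lia.
Qed.

Definition cycle_tau (e : {set 'I_n}) : seq bool :=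
  if [pick i | e == cycle_edge i] is Some i then mkseq (S i) k else [::].

Lemma cycle_tauE (i : 'I_n) : cycle_tau (cycle_edge i) = mkseq (S i) k.
Proof.
rewrite /cycle_tau; case: pickP => [j /eqP/cycle_edge_inj <- //|/(_ i)].
by rewrite eqxx.
Qed.

Definition cycle_edges : {set {set 'I_n}} := [set cycle_edge i | i : 'I_n].

Fact cycle_edges_card2 e : e \in cycle_edges -> #|e| = 2.
Proof. by case/imsetP => i _ ->; rewrite cards2 ordS_neq. Qed.

Fact cycle_edges_exist e : e \in cycle_edges -> exists t, exists_at (cycle_tau e) t.
Proof.
case/imsetP => i _ ->; have [t tk St] := S_some (ltn_ord i).
by exists t; rewrite cycle_tauE exists_at_mkseq // modn_small.
Qed.

Definition periodic_cycle : ep_graph 'I_n := EPGraph cycle_edges_card2 cycle_edges_exist.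

Lemma next_enum_ord (v : 'I_n) : next (enum 'I_n) v = ordS v.
Proof.
have h : 0 < n by lia.
apply: ord_inj; rewrite val_ordS next_nth mem_enum /=.
case e: (enum 'I_n) => [|y s]; first by have := size_enum_ord n; rewrite e /=; lia.
have iv : index v (enum 'I_n) = v by rewrite index_enum_ord.
have sz : (size s).+1 = n by have := size_enum_ord n; rewrite e.
have y0 : y = 0 :> nat by have := nth_enum_ord y h; rewrite e.
(* [next] wraps around through the default value of [nth], here the head [y] of the enumeration,
   which is [0]. *)
rewrite -e iv; case: eqP => vn; first by rewrite nth_default ?y0 // -ltnS sz vn.
have lt : v.+1 < n by have := ltn_ord v; lia.
by have := nth_enum_ord y lt; rewrite e.
Qed.

Lemma periodic_cycle_is_cycle : is_ep_cycle periodic_cycle.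
Proof.
exists (enum 'I_n); split; rewrite ?enum_uniq ?size_enum_ord //.
  by move=> v; rewrite mem_enum.
by apply: eq_imset => v; rewrite next_enum_ord.
Qed.

Lemma cycle_periods : ep_periods periodic_cycle = [:: k].
Proof.
rewrite /ep_periods.
set s := [seq _ | _ in _].
have mem_s x : x \in s -> x = k.
  by case/mapP => e; rewrite mem_enum => /imsetP[i _ ->] ->; rewrite /= cycle_tauE size_mkseq.
have h : 0 < n by lia.
have ks : k \in s.
  apply/mapP; exists (cycle_edge (Ordinal h)); last by rewrite /= cycle_tauE size_mkseq.
  by rewrite mem_enum; apply/imsetP; exists (Ordinal h).
apply: perm_small_eq => //; apply: uniq_perm; rewrite ?undup_uniq // => x.
rewrite mem_undup inE; apply/idP/eqP => [/mem_s //|-> //].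
Qed.

Lemma cycle_max : ep_max periodic_cycle = k.
Proof. by rewrite /ep_max cycle_periods big_seq1. Qed.

Lemma cycle_lcm : ep_lcm periodic_cycle = k.
Proof. by rewrite /ep_lcm cycle_periods big_seq1. Qed.

(** Moves on natural numbers, with the wrap-around edge kept apart, so that linear arithmetic
    applies. *)
Definition cycle_step (t u v : nat) : Prop :=
  [\/ u = v,
      u.+1 = v /\ S u (t %% k) \/ v.+1 = u /\ S v (t %% k) |
      [/\ u.+1 = n, v = 0 & S u (t %% k)] \/ [/\ v.+1 = n, u = 0 & S v (t %% k)]].

Lemma cycle_legalP (t : nat) (u v : 'I_n) :
  legal_move periodic_cycle t u v <-> cycle_step t u v.
Proof.
have ltu := ltn_ord u; have ltv := ltn_ord v.
have next_legal (x y : 'I_n) : y = ordS x -> S x (t %% k) ->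
    [set x; y] \in ep_edges periodic_cycle /\ exists_at (ep_tau periodic_cycle [set x; y]) t.
  move=> -> Sx; split; first by apply/imsetP; exists x.
  by rewrite /= -/(cycle_edge x) cycle_tauE exists_at_mkseq.
split=> [[->|[/imsetP[i _ e] ex]]|].
- exact: Or31.
- move: ex; rewrite /= e cycle_tauE exists_at_mkseq // => Si.
  have uv : (u == i) && (v == ordS i) || (v == i) && (u == ordS i).
    have hu : u \in cycle_edge i by rewrite -e set21.
    have hv : v \in cycle_edge i by rewrite -e set22.
    have hi : i \in [set u; v] by rewrite e set21.
    have hj : ordS i \in [set u; v] by rewrite e set22.
    have := ordS_neq i.
    case/set2P: hu hi hj => ->; case/set2P: hv => ->; rewrite !inE !eqxx ?orbT //.
      by rewrite orbb eq_sym => _ ->.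
    by rewrite orbb => ->.
  case/orP: uv => /andP[/eqP a /eqP b]; subst.
    have := val_ordS i; case: eqP => [ie ->|_ ->]; last by apply: Or32; left.
    by apply: Or33; left.
  have := val_ordS i; case: eqP => [ie ->|_ ->]; last by apply: Or32; right.
  by apply: Or33; right.
case=> [/ord_inj|[[e Su]|[e Sv]]|[[e v0 Su]|[e u0 Sv]]].
- by left.
- by right; apply: next_legal => //; apply: ord_inj; rewrite val_ordS; case: eqP; lia.
- by right; rewrite setUC; apply: next_legal => //; apply: ord_inj; rewrite val_ordS; case: eqP; lia.
- by right; apply: next_legal => //; apply: ord_inj; rewrite val_ordS e eqxx v0.
- by right; rewrite setUC; apply: next_legal => //; apply: ord_inj; rewrite val_ordS e eqxx u0.
Qed.

(** * Reduction to a robber on the positive side of a symmetric cycle *)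

Hypothesis S_sym : forall i t, i < n -> S (n - i.+1) t = S i t.

(** The reflection of [v] to [n - v] about [0] sends the edge from [i] to the edge from [n - i.+1],
    so by [S_sym] it preserves legal moves. A robber starting at [0] is met at once. *)
Lemma cycle_cop_winning (p : nat -> nat) :
  p 0 = 0 -> (forall t, p t < n) -> (forall t, cycle_step t (p t) (p t.+1)) ->
  (forall r : nat -> nat, (forall t, r t < n) ->
     (forall t, cycle_step t (r t) (r t.+1)) -> 0 < r 0 <= n./2 ->
     exists t, r t = p t \/ r t = p t.+1) ->
  cop_winning periodic_cycle.
Proof.
move=> p0 p_lt p_step p_meets.
have n_gt0 : 0 < n by lia.
have f_lt (v : 'I_n) : (if v == 0 :> nat then 0 else n - v) < n.
  by have := ltn_ord v; case: eqP => /=; lia.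
pose f v := Ordinal (f_lt v).
apply: (@cop_winning_reflection _ _ f (fun v => v <= n./2) (fun t => Ordinal (p_lt t))).
- move=> v; apply: ord_inj => /=; have := ltn_ord v.
  by case: (nat_of_ord v =P 0) => [->|] //=; case: eqP; lia.
- by apply: ord_inj; rewrite /= p0.
- move=> t u v /cycle_legalP uv; apply/cycle_legalP; rewrite /f /=.
  have ltu := ltn_ord u; have ltv := ltn_ord v.
  case: uv => [/ord_inj ->|[[e Su]|[e Sv]]|[[e v0 Su]|[e u0 Sv]]].
  + exact: Or31.
  + have := S_sym (t %% k) ltu; rewrite Su => Su'.
    case: (nat_of_ord u =P 0) => u0; case: (nat_of_ord v =P 0) => v0; try lia.
      apply: Or33; right; split; try lia; by rewrite -e.
    apply: Or32; right; split; first by lia.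
    by rewrite -e.
  + have := S_sym (t %% k) ltv; rewrite Sv => Sv'.
    case: (nat_of_ord u =P 0) => u0; case: (nat_of_ord v =P 0) => v0; try lia.
      apply: Or33; left; split; try lia; by rewrite -e.
    apply: Or32; left; split; first by lia.
    by rewrite -e.
  + have := S_sym (t %% k) ltu; rewrite Su e subnn => S0.
    rewrite v0 eqxx; case: (nat_of_ord u =P 0) => u0; first by apply: Or31.
    have -> : n - u = 1 by lia.
    by apply: Or32; right.
  + have := S_sym (t %% k) ltv; rewrite Sv e subnn => S0.
    rewrite u0 eqxx; case: (nat_of_ord v =P 0) => v0; first by apply: Or31.
    have -> : n - v = 1 by lia.
    by apply: Or32; left.
- by move=> v /=; have := ltn_ord v; case: (nat_of_ord v =P 0); lia.
- by move=> t; apply/cycle_legalP.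
move=> r r_run r0.
case: (posnP (r 0)) => [z|r_pos].
  by exists 0; left; apply: ord_inj; rewrite /= z p0.
have [] := p_meets (fun t => val (r t)).
- by move=> t; apply: ltn_ord.
- by move=> t; apply/cycle_legalP.
- by rewrite r_pos.
by move=> t meet; exists t; case: meet => e; [left|right]; apply: ord_inj.
Qed.

End PeriodicCycle.

Arguments periodic_cycle {n k S}.

(** * Gated labellings and the pursuits on them *)

Definition one_gate (k i t : nat) : bool := (i == k.-1) ==> (t == k.-1).

(** With [n = 4 * k - 1], edges [0] and [4 * k - 2] are those at vertex [0], and edge [(2 * k).-1]
    is opposite to it. *)
Definition three_gates (k i t : nat) : bool :=
  ((i == 0) || (i == 4 * k - 2) ==> (t == 0)) &&
  ((i == (2 * k).-1) ==> (t == k.-1)).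

Lemma one_gate_meets (k : nat) (r : nat -> nat) :
  2 <= k -> (forall t, r t < 2 * k - 1) ->
  (forall t, cycle_step (2 * k - 1) k (one_gate k) t (r t) (r t.+1)) ->
  0 < r 0 <= (2 * k - 1)./2 ->
  exists t, r t = minn t k.-1 \/ r t = minn t.+1 k.-1.
Proof.
move=> k2 r_lt r_step r0.
suff /(_ k.-2) ahead : forall t, t <= k.-2 ->
    (exists s, r s = minn s k.-1 \/ r s = minn s.+1 k.-1) \/ t < r t <= k.-1.
  (* At time [k - 2] the invariant leaves only vertex [k - 1], the cop's next one. *)
  have [//|//|rk] := ahead; by exists k.-2; right; lia.
elim=> [_|t IH tk]; first by right; lia.
have [|//|rt] := IH; [lia|by left|].
have tmod : t %% k = t by rewrite modn_small //; lia.
case: (r t =P minn t.+1 k.-1) => [e|ne]; first by left; exists t; right.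
case: (r t.+1 =P minn t.+1 k.-1) => [e|ne']; first by left; exists t.+1; left.
right; have := r_step t; rewrite /cycle_step /one_gate tmod.
by case=> [|[[]|[]]|[[]|[]]]; lia.
Qed.

(* [c * k] is the time at which the cop, waiting at [4k - 2], crosses back to
   vertex [0]. *)
Lemma three_gates_meets (k c : nat) (r : nat -> nat) :
  2 <= k -> 4 * k - 2 <= c * k < 5 * k - 2 -> (forall t, r t < 4 * k - 1) ->
  (forall t, cycle_step (4 * k - 1) k (three_gates k) t (r t) (r t.+1)) ->
  0 < r 0 <= (4 * k - 1)./2 ->
  let p t := if t <= c * k then minn t (4 * k - 2) else 0 in
  exists t, r t = p t \/ r t = p t.+1.
Proof.
move=> k2 ck r_lt r_step r0 p.
(* [w] is the robber's position unrolled along the cop's walk, so that vertex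
   [0] counts as [4k - 1]. *)
pose ahead t := let w := if r t == 0 then 4 * k - 1 else r t in
  (* Before time [k] the robber is short of the opposite gate; afterwards it gains at most one
     vertex per step. The last clause says that no multiple of [k] lies between [t] and [c * k], the
     latter excluded, so a robber on [0] is stuck there until the cop crosses. *)
  [/\ minn t (4 * k - 2) < w, t < k -> w < 2 * k, k <= t -> w <= t + k &
      r t = 0 -> c * k < t + k].
suff /(_ (c * k)) : forall t, t <= c * k ->
    (exists s, r s = p s \/ r s = p s.+1) \/ ahead t.
  (* The cop is then at [4 * k - 2], so the robber ahead of it can only be on [0]. *)
  case=> [//|//|[w_gt _ _ _]]; exists (c * k); right; rewrite /p ltnn.
  by move: w_gt (r_lt (c * k)); case: (r (c * k) =P 0); lia.
have mult t d : t %% k = 0 -> c * k < t + d * k + k -> c * k <= t + d * k.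
  move=> /eqP /dvdnP[a ->]; rewrite -mulnDl -mulSnr.
  by rewrite ltn_pmul2r ?leq_pmul2r //; lia.
elim=> [_|t IH tk].
  by right; rewrite /ahead; case: (r 0 =P 0); split; lia.
have [|//|[w_gt w_lt w_le w_z]] := IH; [lia|by left|].
case: (r t =P p t.+1) => [e|ne]; first by left; exists t; right.
case: (r t.+1 =P p t.+1) => [e|ne']; first by left; exists t.+1; left.
right; have := r_step t; have := r_lt t; have := r_lt t.+1.
move: ne ne'; rewrite /p tk /cycle_step /three_gates /ahead.
have tmod : t < k -> t %% k = t by move=> ?; rewrite modn_small.
have m0 := mult t 0; have m1 := mult t 1.
rewrite mul0n addn0 in m0; rewrite mul1n in m1.
move: ck tk m0 m1 w_gt w_lt w_le w_z tmod; clear -k2.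
move: (r t) (r t.+1) (c * k) (t %% k) => u v T m ck tk m0 m1 w_gt w_lt w_le w_z tmod.
move=> ne ne' ltv ltu.
have {ne}w_gt : minn t.+1 (4 * k - 2) < (if u == 0 then 4 * k - 1 else u).
  by move: w_gt ne; case: eqP => _; clear; lia.
case: (ltnP t k) => tk'.
  have {w_lt}w_lt := w_lt tk'; have {tmod}tmod := tmod tk'; subst m.
  move: w_gt w_lt {w_le m0 m1}; case: eqP => [|u0] w_gt w_lt; first by lia.
  by case: (v =P 0) => vn; case=> [e|[[e g]|[e g]]|[[e v0 g]|[e v0 g]]]; split; lia.
have {w_le tmod w_lt}w_le := w_le tk'.
case=> [e|[[e g]|[e g]]|[[e v0 g]|[e v0 g]]].
- by subst v; split; lia.
- have vn : v == 0 = false by lia.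
  rewrite vn; case: (u =P 0) => [u0|un].
    (* Leaving [0] needs an open gate, hence a multiple of [k] that the last clause of the invariant
       excludes. *)
    have m_0 : m = 0 by move: g; rewrite u0 eqxx /= => /andP[/eqP].
    by have := m0 m_0; lia.
  by move: w_gt w_le; rewrite (introF eqP un); split; lia.
- have un : u == 0 = false by lia.
  move: w_gt w_le; rewrite un; case: (v =P 0) => [v0|vn]; first by lia.
  by split; lia.
(* Entering [0] forces [4 * k - 2 <= t + k], so [c * k < 5 * k - 2 <= t + 2 * k]; both ends being
   multiples of [k], this gives [c * k <= t + k]. *)
- have uE : u = 4 * k - 2 by lia.
  have m_0 : m = 0 by move: g; rewrite uE eqxx orbT => /andP[/eqP].
  have un : u == 0 = false by lia.
  move: w_gt w_le; rewrite un v0 eqxx => w_gt w_le.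
  by have := m1 m_0; split; lia.
- have vn : v == 0 = false by lia.
  by move: w_gt w_le; rewrite vn v0 eqxx; split; lia.
Qed.

(** * The cop's walks for [l = 1] and [l = 2] *)

Theorem theorem3 (k l : nat) (hk : 2 <= k) (hl : l = 1 \/ l = 2) :
  exists (V : finType) (G : ep_graph V),
    [/\ is_ep_cycle G, cop_winning G, ep_max G = k &
        #|V| = 2 * l * ep_lcm G - 1].
Proof.
have k0 : 0 < k by lia.
case: hl => ->.
  have n3 : 3 <= 2 * k - 1 by lia.
  have some i : i < 2 * k - 1 -> exists2 t, t < k & one_gate k i t.
    by exists k.-1; rewrite ?/one_gate ?eqxx ?implybT //; lia.
  exists 'I_(2 * k - 1), (periodic_cycle n3 k0 some); split.
  - exact: periodic_cycle_is_cycle.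
  - apply: (@cycle_cop_winning _ _ _ _ _ _ _ (fun t => minn t k.-1)).
    + by move=> i t ik; rewrite /one_gate; congr (_ ==> _); lia.
    + by rewrite min0n.
    + by move=> t; lia.
    + move=> t; rewrite /cycle_step /one_gate.
      case: (ltnP t k.-1) => tk; last by apply: Or31; lia.
      by apply: Or32; left; split; lia.
    + by move=> r; apply: one_gate_meets.
  - exact: cycle_max.
  - by rewrite card_ord cycle_lcm muln1.
have n3 : 3 <= 4 * k - 1 by lia.
have some i : i < 4 * k - 1 -> exists2 t, t < k & three_gates k i t.
  move=> _; exists (if i == (2 * k).-1 then k.-1 else 0); first by case: ifP; lia.
  by rewrite /three_gates; case: (i =P (2 * k).-1); lia.
(* An interval of length [k] contains a multiple of [k]: here [4 * k] if [k > 2], and [6] if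
   [k = 2]. *)
have [c ck] : exists c, 4 * k - 2 <= c * k < 5 * k - 2.
  by case: (ltngtP k 2) hk => // [k3|k2] _; [exists 4|exists 3]; lia.
exists 'I_(4 * k - 1), (periodic_cycle n3 k0 some); split.
- exact: periodic_cycle_is_cycle.
- apply: (@cycle_cop_winning _ _ _ _ _ _ _
            (fun t => if t <= c * k then minn t (4 * k - 2) else 0)).
  + by move=> i t ik; rewrite /three_gates; congr ((_ ==> _) && (_ ==> _)); lia.
  + by rewrite leq0n min0n.
  + by move=> t; case: ifP; lia.
  + move=> t; rewrite /cycle_step /three_gates.
    case: (ltngtP t (c * k)) => tc.
    * case: (ltnP t (4 * k - 2)) => tk; last by apply: Or31; lia.
      apply: Or32; left.
      split; first by lia.
      (* The cop takes edge [t] at time [t], so it meets gate [0] at time [0] and the opposite gate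
         at time [2 * k - 1], both open. *)
      case: (t =P 0) => [->|t0]; first by rewrite mod0n; lia.
      case: (t =P (2 * k).-1) => [->|]; last by lia.
      have -> : (2 * k).-1 = k + k.-1 by lia.
      by rewrite modnDl modn_small; lia.
    * by apply: Or31.
    * by rewrite tc modnMl; apply: Or33; left; split; lia.
  + by move=> r; apply: three_gates_meets.
- exact: cycle_max.
- by rewrite card_ord cycle_lcm.
Qed.
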